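(* BigSpernerFamily $\le_{ql}$ BigTwoDisjointSets.
   Context: Quasilinear reductions: for an instance $I$ let $s(I)$ be its size. A quasilinear Karp reduction from problem $\mathcal P$ to problem $\mathcal Q$ (written $\mathcal P\le_{ql}\mathcal Q$) is a function $\Phi$ from instances of $\mathcal P$ to instances of $\mathcal Q$ such that for every instance $I$ of $\mathcal P$: $\Phi(I)$ can be computed in time $\tilde O(s(I))$ (that is, $O(s(I)\log^j s(I))$ for a fixed $j$), and $I$ and $\Phi(I)$ have the same output. In the following problems the input is a finite set $X$ and a collection $\mathcal C$ of subsets of $X$ with $|X|<\log^{c}(|\mathcal C|)$ for a fixed constant $c$ (sets represented as lists of elements). BigTwoDisjointSets: output True if there are two disjoint sets $C,C'\in\mathcal C$, False otherwise. BigSpernerFamily: output True if there are two (distinct) sets $C,C'\in\mathcal C$ with $C\subseteq C'$, False otherwise. *)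

(* Defs.v *)
From Stdlib Require Export Reals List Arith.
Export ListNotations.

Set Implicit Arguments.

(** * Random access machine with logarithmic cost

    The machine has an unbounded memory of natural numbers (initially all 0), a
    one-way input tape and a one-way output tape of natural numbers.  Control
    flow is structured ([If], [While]) instead of being given by jumps.  The
    charge for an operand or an address is the total bit length of every number
    occurring in its evaluation, addresses included.  The arithmetic operations
    are addition and truncated subtraction. *)

Definition bitlen (n : nat) : nat := S (Nat.log2 n).

Definition memory := nat -> nat.

Inductive operand : Type :=
| Lit (n : nat)
| Dir (a : nat)
| Ind (a : nat).

Inductive dest : Type :=
| ToDir (a : nat)
| ToInd (a : nat).

Inductive cmd : Type :=
| Skip
| Move (d : dest) (x : operand)
| Add (d : dest) (x y : operand)
| Sub (d : dest) (x y : operand)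
| Read (d : dest)
| Write (x : operand)
| Seq (p q : cmd)
| If (x : operand) (p q : cmd)
| While (x : operand) (p : cmd).

Definition oval (m : memory) (x : operand) : nat :=
  match x with
  | Lit n => n
  | Dir a => m a
  | Ind a => m (m a)
  end.

Definition ocost (m : memory) (x : operand) : nat :=
  match x with
  | Lit n => bitlen n
  | Dir a => bitlen a + bitlen (m a)
  | Ind a => bitlen a + bitlen (m a) + bitlen (m (m a))
  end.

Definition daddr (m : memory) (d : dest) : nat :=
  match d with
  | ToDir a => a
  | ToInd a => m a
  end.

Definition dcost (m : memory) (d : dest) : nat :=
  match d with
  | ToDir a => bitlen a
  | ToInd a => bitlen a + bitlen (m a)
  end.

Definition upd (m : memory) (a v : nat) : memory :=
  fun b => if Nat.eqb b a then v else m b.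

Record state : Type := State {
  mem : memory;
  inp : list nat;
  out : list nat
}.

Definition store (s : state) (d : dest) (v : nat) : state :=
  State (upd (mem s) (daddr (mem s) d) v) (inp s) (out s).

(* [exec p s t s']: started in [s], the program [p] halts in [s'] at total
   cost [t].  Reading past the end of the input yields 0; tests in [If] and
   [While] succeed on nonzero values. *)
Inductive exec : cmd -> state -> nat -> state -> Prop :=
| exec_Skip s : exec Skip s 1 s
| exec_Move d x s :
    exec (Move d x) s
      (1 + dcost (mem s) d + ocost (mem s) x)
      (store s d (oval (mem s) x))
| exec_Add d x y s :
    exec (Add d x y) s
      (1 + dcost (mem s) d + ocost (mem s) x + ocost (mem s) y)
      (store s d (oval (mem s) x + oval (mem s) y))
| exec_Sub d x y s :
    exec (Sub d x y) s
      (1 + dcost (mem s) d + ocost (mem s) x + ocost (mem s) y)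
      (store s d (oval (mem s) x - oval (mem s) y))
| exec_Read d s :
    exec (Read d) s
      (1 + dcost (mem s) d + bitlen (hd 0 (inp s)))
      (store (State (mem s) (tl (inp s)) (out s)) d (hd 0 (inp s)))
| exec_Write x s :
    exec (Write x) s
      (1 + ocost (mem s) x)
      (State (mem s) (inp s) (out s ++ [oval (mem s) x]))
| exec_Seq p q s1 s2 s3 t1 t2 :
    exec p s1 t1 s2 -> exec q s2 t2 s3 ->
    exec (Seq p q) s1 (t1 + t2) s3
| exec_If_true x p q s s' t :
    oval (mem s) x <> 0 -> exec p s t s' ->
    exec (If x p q) s (1 + ocost (mem s) x + t) s'
| exec_If_false x p q s s' t :
    oval (mem s) x = 0 -> exec q s t s' ->
    exec (If x p q) s (1 + ocost (mem s) x + t) s'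
| exec_While_true x p s1 s2 s3 t1 t2 :
    oval (mem s1) x <> 0 -> exec p s1 t1 s2 -> exec (While x p) s2 t2 s3 ->
    exec (While x p) s1 (1 + ocost (mem s1) x + t1 + t2) s3
| exec_While_false x p s :
    oval (mem s) x = 0 ->
    exec (While x p) s (1 + ocost (mem s) x) s.

Definition initial (input : list nat) : state :=
  State (fun _ => 0) input [].

Definition runs (p : cmd) (input : list nat) (t : nat) (output : list nat)
  : Prop :=
  exists s, exec p (initial input) t s /\ out s = output.

(** * Decision problems and quasilinear Karp reductions *)

Record problem : Type := Problem {
  instance : Type;
  encode : instance -> list nat;
  answer : instance -> Prop
}.

Arguments encode {p} _.
Arguments answer {p} _.

Definition size (P : problem) (I : instance P) : nat :=
  list_sum (map bitlen (encode I)).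

Definition log2 (x : R) : R := (ln x / ln 2)%R.

Definition quasilinear_time (P Q : problem) (Phi : instance P -> instance Q)
  : Prop :=
  exists (p : cmd) (K : R) (j N : nat), forall I : instance P,
  exists t : nat,
    runs p (encode I) t (encode (Phi I)) /\
    (N <= size P I ->
     (INR t <= K * (INR (size P I) * log2 (INR (size P I)) ^ j))%R).

Definition ql_reduces (P Q : problem) : Prop :=
  exists Phi : instance P -> instance Q,
    quasilinear_time P Q Phi /\
    (forall I : instance P, answer I <-> answer (Phi I)).

(** * The two problems *)

Definition same_set (A B : list nat) : Prop := incl A B /\ incl B A.

Definition disjoint (A B : list nat) : Prop := forall x, In x A -> ~ In x B.

(* A set is listed without repetition, in arbitrary order; its elements are
   named by arbitrary natural numbers.  The family lists each of its members
   once, up to equality of sets, so that [length family] is its cardinality.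

   The conjunct [1 < length family] in [big_small] costs no generality:
   [|X| < log^c |C|] fails when [|C| = 1] and is undefined when [|C| = 0], but
   [Rpower] takes a junk value at the base 0. *)
Record big_instance (c : R) : Type := BigInstance {
  ground : list nat;
  family : list (list nat);
  ground_nodup : NoDup ground;
  family_sets : forall A, In A family -> NoDup A /\ incl A ground;
  family_distinct : ForallOrdPairs (fun A B => ~ same_set A B) family;
  big_small :
    1 < length family /\
    (INR (length ground) < Rpower (log2 (INR (length family))) c)%R
}.

Definition encode_list (A : list nat) : list nat := length A :: A.

Definition encode_big (c : R) (I : big_instance c) : list nat :=
  encode_list (ground I) ++
  length (family I) :: flat_map encode_list (family I).

Definition BigTwoDisjointSets (c : R) : problem :=
  Problem (@encode_big c)
    (fun I => exists A B, In A (family I) /\ In B (family I) /\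
       ~ same_set A B /\ disjoint A B).

Definition BigSpernerFamily (c : R) : problem :=
  Problem (@encode_big c)
    (fun I => exists A B, In A (family I) /\ In B (family I) /\
       ~ same_set A B /\ incl A B).

(* Main.v *)
(* Renaming the ground set by indices [0 .. n-1], send a member [C] of the family
   to two sets over [X + {t_0, ..., t_(n+1)}]:
     upper C = C + {t_0, ..., t_|C|},
     lower C = (X \ C) + {t_|C|, ..., t_(n+1)}.
   Any two upper sets share [t_0] and any two lower sets share [t_(n+1)], while
   [upper C] and [lower D] are disjoint iff [C] is included in [D] and
   [|C| < |D|].  The renaming is needed for the running time: complements taken
   with the original names could repeat one very long name in every set.  The
   machine performs it by using the names as addresses of a dictionary.  Each
   member of the family costs [O(n)] operations on numbers of [O(log n)] bits
   besides reading it, and [n] is polylogarithmic in the number of members. *)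
From Stdlib Require Import Lia Lra.
Require Import Defs.

Arguments bitlen : simpl never.

(** * A weakest precondition calculus with costs *)

(** Total correctness: a halting run is exhibited rather than assumed, so a single statement
    delivers termination, cost and output. *)
Definition wp (p : cmd) (s : state) (Q : nat -> state -> Prop) : Prop :=
  exists t s', exec p s t s' /\ Q t s'.

Lemma wp_conseq p s (Q Q' : nat -> state -> Prop) :
  wp p s Q -> (forall t s', Q t s' -> Q' t s') -> wp p s Q'.
Proof. intros (t & s' & He & HQ) H; exists t, s'; auto. Qed.

Lemma wp_Move d x s (Q : nat -> state -> Prop) :
  Q (1 + dcost (mem s) d + ocost (mem s) x) (store s d (oval (mem s) x)) ->
  wp (Move d x) s Q.
Proof. intros H; do 2 eexists; split; [constructor | exact H]. Qed.

Lemma wp_Add d x y s (Q : nat -> state -> Prop) :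
  Q (1 + dcost (mem s) d + ocost (mem s) x + ocost (mem s) y)
    (store s d (oval (mem s) x + oval (mem s) y)) ->
  wp (Add d x y) s Q.
Proof. intros H; do 2 eexists; split; [constructor | exact H]. Qed.

Lemma wp_Sub d x y s (Q : nat -> state -> Prop) :
  Q (1 + dcost (mem s) d + ocost (mem s) x + ocost (mem s) y)
    (store s d (oval (mem s) x - oval (mem s) y)) ->
  wp (Sub d x y) s Q.
Proof. intros H; do 2 eexists; split; [constructor | exact H]. Qed.

Lemma wp_Read d s (Q : nat -> state -> Prop) :
  Q (1 + dcost (mem s) d + bitlen (hd 0 (inp s)))
    (store (State (mem s) (tl (inp s)) (out s)) d (hd 0 (inp s))) ->
  wp (Read d) s Q.
Proof. intros H; do 2 eexists; split; [constructor | exact H]. Qed.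

Lemma wp_Write x s (Q : nat -> state -> Prop) :
  Q (1 + ocost (mem s) x)
    (State (mem s) (inp s) (out s ++ [oval (mem s) x])) ->
  wp (Write x) s Q.
Proof. intros H; do 2 eexists; split; [constructor | exact H]. Qed.

Lemma wp_Seq p q s (Q : nat -> state -> Prop) :
  wp p s (fun t1 s1 => wp q s1 (fun t2 s2 => Q (t1 + t2) s2)) ->
  wp (Seq p q) s Q.
Proof.
  intros (t1 & s1 & H1 & t2 & s2 & H2 & H).
  exists (t1 + t2), s2; split; [econstructor; eauto | exact H].
Qed.

Lemma wp_If x p q s (Q : nat -> state -> Prop) :
  (oval (mem s) x <> 0 -> wp p s (fun t => Q (1 + ocost (mem s) x + t))) ->
  (oval (mem s) x = 0 -> wp q s (fun t => Q (1 + ocost (mem s) x + t))) ->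
  wp (If x p q) s Q.
Proof.
  intros Hp Hq; destruct (Nat.eq_dec (oval (mem s) x) 0) as [E | E].
  - destruct (Hq E) as (t & s' & H & HQ).
    do 2 eexists; split; [eapply exec_If_false; eauto | exact HQ].
  - destruct (Hp E) as (t & s' & H & HQ).
    do 2 eexists; split; [eapply exec_If_true; eauto | exact HQ].
Qed.

Lemma wp_While_true x p s (Q : nat -> state -> Prop) :
  oval (mem s) x <> 0 ->
  wp p s (fun t1 s1 =>
    wp (While x p) s1 (fun t2 => Q (1 + ocost (mem s) x + t1 + t2))) ->
  wp (While x p) s Q.
Proof.
  intros Hx (t1 & s1 & H1 & t2 & s2 & H2 & H).
  do 2 eexists; split; [eapply exec_While_true; eauto | exact H].
Qed.

Lemma wp_While_false x p s (Q : nat -> state -> Prop) :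
  oval (mem s) x = 0 -> Q (1 + ocost (mem s) x) s -> wp (While x p) s Q.
Proof.
  intros Hx H; do 2 eexists; split; [eapply exec_While_false; eauto | exact H].
Qed.

(** * Memory updates and bit lengths *)

Lemma upd_eq m a v : upd m a v a = v.
Proof. unfold upd; now rewrite Nat.eqb_refl. Qed.

Lemma upd_neq m a v b : b <> a -> upd m a v b = m b.
Proof. unfold upd; intros H; now rewrite (proj2 (Nat.eqb_neq b a) H). Qed.

Lemma bitlen_pos n : 1 <= bitlen n.
Proof. unfold bitlen; lia. Qed.

Lemma bitlen_le a b : a <= b -> bitlen a <= bitlen b.
Proof. intros H; unfold bitlen; apply le_n_S, Nat.log2_le_mono, H. Qed.

(** The sum is at most twice the larger summand, which costs one extra bit; the smaller summand pays
    for it, having bit length at least 1. *)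
Lemma bitlen_add a b : bitlen (a + b) <= bitlen a + bitlen b.
Proof.
  pose proof (bitlen_pos a); pose proof (bitlen_pos b).
  destruct (Nat.eq_dec (Nat.max a b) 0) as [E | E].
  { replace (a + b) with a by lia; lia. }
  pose proof (@bitlen_le (a + b) (2 * Nat.max a b) ltac:(lia)) as H1.
  unfold bitlen in H1 at 2; rewrite Nat.log2_double in H1 by lia.
  change (S (Nat.log2 (Nat.max a b))) with (bitlen (Nat.max a b)) in H1.
  destruct (Nat.max_spec a b) as [[_ M] | [_ M]]; rewrite M in H1; lia.
Qed.

Lemma bitlen_bound n : bitlen n <= S n.
Proof. unfold bitlen; pose proof (Nat.log2_le_lin n); lia. Qed.

Ltac step :=
  lazymatch goal with
  | |- wp (Seq _ _) _ _ => apply wp_Seq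
  | |- wp (Move _ _) _ _ => apply wp_Move
  | |- wp (Add _ _ _) _ _ => apply wp_Add
  | |- wp (Sub _ _ _) _ _ => apply wp_Sub
  | |- wp (Read _) _ _ => apply wp_Read
  | |- wp (Write _) _ _ => apply wp_Write
  end.

Ltac cbnm := cbn [mem inp out store oval ocost daddr dcost upd Nat.eqb hd tl
  Nat.add app].

Ltac const_bits :=
  change (bitlen 0) with 1; change (bitlen 1) with 1;
  change (bitlen 2) with 2; change (bitlen 3) with 2;
  change (bitlen 4) with 3; change (bitlen 5) with 3;
  change (bitlen 6) with 3; change (bitlen 7) with 3;
  change (bitlen 8) with 4; change (bitlen 10) with 4;
  change (bitlen 11) with 4.

(** * The program *)

(* The memory is laid out as registers below 10, the dictionary at the even
   addresses [10 + 2 x] ([slot x], for an original name [x]), and the marks of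
   the set being read at the odd addresses [11 + 2 i] ([name i], for an index
   [i]).  The address [name i] also serves as the new name of the element of
   index [i], and [t_j] is the even number [2 j]. *)
Notation rN := 1 (only parsing).
Notation rCount := 2 (only parsing).
Notation rElt := 3 (only parsing).
Notation rPtr := 4 (only parsing).
Notation rFam := 5 (only parsing).
Notation rCard := 6 (only parsing).
Notation rTmp := 7 (only parsing).
Notation rEven := 8 (only parsing).

Notation "p ;; q" := (Seq p q) (at level 60, right associativity).

(** * Emission of the tags [t_j] *)

Definition decr_count : cmd := Sub (ToDir rCount) (Dir rCount) (Lit 1).

Definition write_evens : cmd :=
  While (Dir rCount)
    (Write (Dir rEven);;
     Add (ToDir rEven) (Lit 2) (Dir rEven);;
     decr_count).

Definition evens (a c : nat) : list nat := map (fun i => 2 * i) (seq a c).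

(** [T] caps every number that the loop handles, so each iteration costs a constant multiple of
    [bitlen T]. The last clause is a frame condition: only the counter and the current tag
    change. *)
Lemma write_evens_spec T c : forall a s,
  mem s 2 = c -> mem s 8 = 2 * a -> 2 * (a + c) <= T ->
  wp write_evens s (fun t s' =>
    t <= (c + 1) * (40 * bitlen T) /\ inp s' = inp s /\
    out s' = out s ++ evens a c /\
    (forall b, b <> 2 -> b <> 8 -> mem s' b = mem s b)).
Proof.
  induction c as [|c IH]; intros a s H2 H8 HT; unfold write_evens.
  - apply wp_While_false; [exact H2 |].
    pose proof (bitlen_pos T).
    cbnm; rewrite H2; const_bits; unfold evens; simpl; rewrite app_nil_r.
    repeat split; lia.
  - apply wp_While_true; [cbnm; lia |].
    unfold decr_count; repeat step; cbnm; rewrite H2, H8.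
    eapply wp_conseq; [apply (IH (S a)); cbnm; lia |].
    intros t s' (Ht & Hi & Ho & Hm); cbnm; cbn [inp out mem store daddr] in *.
    repeat split.
    + const_bits.
      pose proof (bitlen_pos T).
      pose proof (@bitlen_le (2 * a) T ltac:(lia)).
      pose proof (@bitlen_le (S c) T ltac:(lia)).
      lia.
    + exact Hi.
    + rewrite Ho, <- app_assoc; reflexivity.
    + intros b b2 b8; rewrite Hm by assumption.
      rewrite !upd_neq by assumption; reflexivity.
Qed.

(** * Loading the ground set into the dictionary *)

Definition bits (A : list nat) : nat := list_sum (map bitlen A).

(** Off [X] the value is [length X], outside the range of genuine indices. *)
Fixpoint index (X : list nat) (x : nat) : nat :=
  match X with
  | [] => 0
  | y :: X' => if Nat.eqb y x then 0 else S (index X' x)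
  end.

Definition name (i : nat) : nat := 11 + 2 * i.

Definition slot (x : nat) : nat := 10 + 2 * x.

Definition load_ground : cmd :=
  While (Dir rCount)
    (Read (ToDir rElt);;
     Add (ToDir rTmp) (Dir rElt) (Dir rElt);;
     Add (ToDir rTmp) (Lit 10) (Dir rTmp);;
     Move (ToInd rTmp) (Dir rPtr);;
     Write (Dir rPtr);;
     Add (ToDir rPtr) (Lit 2) (Dir rPtr);;
     decr_count).

(** An original name [x] occurs only as a value or through the address [slot x], of bit length
    linear in [bitlen x]; this is charged to [bits X]. Everything else is capped by [T]. The marks
    are untouched because slots are even and marks odd. *)
Lemma load_ground_spec T rest X : forall i s,
  NoDup X -> mem s 2 = length X -> mem s 4 = name i -> inp s = X ++ rest ->
  name (i + length X) <= T ->
  wp load_ground s (fun t s' =>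
    t <= 100 * bits X + (length X + 1) * (100 * bitlen T) /\ inp s' = rest /\
    out s' = out s ++ map name (seq i (length X)) /\
    mem s' 1 = mem s 1 /\
    (forall x, In x X -> mem s' (slot x) = name (i + index X x)) /\
    (forall x, ~ In x X -> mem s' (slot x) = mem s (slot x)) /\
    (forall j, mem s' (name j) = mem s (name j))).
Proof.
  induction X as [|x X IH]; intros i s HX H2 H4 Hinp HT; unfold load_ground.
  - apply wp_While_false; [exact H2 |].
    pose proof (bitlen_pos T).
    cbnm; rewrite H2; cbn [length]; const_bits; simpl; rewrite app_nil_r.
    repeat split; auto; try lia; tauto.
  - apply wp_While_true; [cbnm; rewrite H2; discriminate |].
    cbn [length] in *; inversion_clear HX as [|? ? Hx HX'].
    unfold decr_count; repeat step; cbnm; rewrite H2, H4, Hinp; cbnm.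
    eapply wp_conseq; [apply (IH (S i)); cbnm; unfold name in *; auto; lia |].
    intros t s' (Ht & Hi & Ho & H1 & Hin & Hout & Hj); cbnm.
    cbn [inp out mem store daddr upd Nat.eqb] in *.
    repeat split.
    + const_bits.
      pose proof (bitlen_pos T).
      pose proof (bitlen_add x x).
      pose proof (bitlen_add 10 (x + x)) as E; change (bitlen 10) with 4 in E.
      cbn [Nat.add] in E.
      pose proof (@bitlen_le (name i) T ltac:(unfold name in *; lia)).
      pose proof (@bitlen_le (S (length X)) T ltac:(unfold name in *; lia)).
      change (bits (x :: X)) with (bitlen x + bits X).
      lia.
    + exact Hi.
    + rewrite Ho, <- app_assoc; reflexivity.
    + exact H1.
    + intros y [<- | Hy].
      (* By [NoDup], [x] does not recur in the tail, so its slot is not overwritten later. *)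
      * rewrite Hout by assumption.
        cbn [index]; rewrite Nat.eqb_refl, Nat.add_0_r.
        rewrite !upd_neq by (unfold slot; lia).
        replace (slot x) with (S (S (S (S (S (S (S (S (S (S (x + x)))))))))))
          by (unfold slot; lia).
        apply upd_eq.
      * rewrite Hin by assumption; cbn [index].
        destruct (Nat.eqb_spec x y) as [-> | _]; [contradiction |].
        f_equal; lia.
    + intros y Hy.
      rewrite Hout by (intros ?; apply Hy; now right).
      assert (x <> y) by (intros ->; apply Hy; now left).
      rewrite !upd_neq by (unfold slot; lia); reflexivity.
    + intros j; rewrite Hj; unfold name.
      rewrite !upd_neq by (unfold slot; lia); reflexivity.
Qed.

(** * Reading a member and marking its indices *)

Definition mark_elements : cmd :=
  While (Dir rCount)
    (Read (ToDir rElt);;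
     Add (ToDir rTmp) (Dir rElt) (Dir rElt);;
     Add (ToDir rTmp) (Lit 10) (Dir rTmp);;
     Move (ToDir rPtr) (Ind rTmp);;
     Move (ToInd rPtr) (Lit 1);;
     Write (Dir rPtr);;
     decr_count).

(** One dictionary lookup per element yields a number that is both the emitted new name and the
    address of its mark. Original names are paid for by [bits C], so [T] need only bound the new
    names and the counter. *)
Lemma mark_elements_spec T g rest C : forall s,
  mem s 2 = length C -> inp s = C ++ rest -> length C <= T ->
  (forall x, In x C -> mem s (slot x) = name (g x) /\ name (g x) <= T) ->
  wp mark_elements s (fun t s' =>
    t <= 100 * bits C + (length C + 1) * (100 * bitlen T) /\ inp s' = rest /\
    out s' = out s ++ map name (map g C) /\
    mem s' 1 = mem s 1 /\ mem s' 5 = mem s 5 /\ mem s' 6 = mem s 6 /\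
    (forall x, mem s' (slot x) = mem s (slot x)) /\
    (forall j, In j (map g C) -> mem s' (name j) = 1) /\
    (forall j, ~ In j (map g C) -> mem s' (name j) = mem s (name j))).
Proof.
  induction C as [|x C IH]; intros s H2 Hinp HT Hg; unfold mark_elements.
  - apply wp_While_false; [exact H2 |].
    pose proof (bitlen_pos T).
    cbnm; rewrite H2; cbn [length]; const_bits; simpl; rewrite app_nil_r.
    repeat split; auto; try lia; tauto.
  - apply wp_While_true; [cbnm; rewrite H2; discriminate |].
    cbn [length] in *.
    destruct (Hg x (or_introl eq_refl)) as [Hx HxT].
    assert (Hx' : mem s (S (S (S (S (S (S (S (S (S (S (x + x)))))))))))
                  = name (g x))
      by (rewrite <- Hx; f_equal; unfold slot; lia).
    unfold decr_count; repeat step; cbnm; rewrite H2, Hinp; cbnm.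
    rewrite Hx'; change (name (g x)) with (11 + 2 * g x); cbnm; rewrite H2.
    eapply wp_conseq; [apply IH; cbnm; try lia |].
    { reflexivity. }
    { intros y Hy; destruct (Hg y (or_intror Hy)) as [Hy1 Hy2].
      split; [| assumption].
      rewrite <- Hy1, !upd_neq by (unfold slot; lia); reflexivity. }
    intros t s' (Ht & Hi & Ho & H1 & H5 & H6 & Hs & Hin & Hout); cbnm.
    cbn [inp out mem store daddr upd Nat.eqb] in *.
    repeat split.
    + const_bits.
      pose proof (bitlen_pos T).
      pose proof (bitlen_add x x).
      pose proof (bitlen_add 10 (x + x)) as E; change (bitlen 10) with 4 in E.
      cbn [Nat.add] in E.
      pose proof (bitlen_le _ _ HxT) as E'; unfold name in E'; cbn [Nat.add] in E'.
      pose proof (bitlen_le _ _ HT).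
      change (bits (x :: C)) with (bitlen x + bits C).
      lia.
    + exact Hi.
    + rewrite Ho, <- app_assoc; reflexivity.
    + exact H1.
    + exact H5.
    + exact H6.
    + intros y; rewrite Hs, !upd_neq by (unfold slot; lia); reflexivity.
    (* The index of the head may recur in the tail, where its mark is set to 1 again; otherwise the
       tail preserves the mark set here. *)
    + intros j Hj; destruct (in_dec Nat.eq_dec j (map g C)) as [Hj' | Hj'];
        [now apply Hin |].
      destruct Hj as [<- | Hj]; [| contradiction].
      rewrite Hout by assumption.
      rewrite upd_neq by (unfold name; lia).
      change (S (S (S (S (S (S (S (S (S (S (S (2 * g x)))))))))))) with (name (g x)).
      apply upd_eq.
    + intros j Hj; cbn [map In] in Hj.
      rewrite Hout by tauto.
      assert (g x <> j) by tauto.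
      rewrite !upd_neq by (unfold name; lia); reflexivity.
Qed.

(** * Emitting the complement and clearing the marks *)

Definition write_unmarked : cmd :=
  While (Dir rCount)
    (If (Ind rPtr) (Move (ToInd rPtr) (Lit 0)) (Write (Dir rPtr));;
     Add (ToDir rPtr) (Lit 2) (Dir rPtr);;
     decr_count).

(** A single sweep emits the unmarked indices and resets the marked ones, which prepares the memory
    for the next member at no further cost. [D] stays fixed during the induction while marks behind
    the sweep are erased; hence marks and [D] are required to agree only from [a] on. *)
Lemma write_unmarked_spec T (D : list nat) c : forall a s,
  mem s 2 = c -> mem s 4 = name a -> name (a + c) <= T ->
  (forall j, mem s (name j) <= T) ->
  (forall j, a <= j -> In j D <-> mem s (name j) <> 0) ->
  wp write_unmarked s (fun t s' =>
    t <= (c + 1) * (100 * bitlen T) /\ inp s' = inp s /\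
    out s' = out s ++
      map name (filter (fun j => if in_dec Nat.eq_dec j D then false else true)
                  (seq a c)) /\
    mem s' 1 = mem s 1 /\ mem s' 5 = mem s 5 /\ mem s' 6 = mem s 6 /\
    (forall x, mem s' (slot x) = mem s (slot x)) /\
    (forall j, a <= j < a + c -> mem s' (name j) = 0) /\
    (forall j, ~ a <= j < a + c -> mem s' (name j) = mem s (name j))).
Proof.
  induction c as [|c IH]; intros a s H2 H4 HT Hle HD; unfold write_unmarked.
  - apply wp_While_false; [exact H2 |].
    pose proof (bitlen_pos T).
    cbnm; rewrite H2; const_bits; simpl; rewrite app_nil_r.
    repeat split; auto; lia.
  - apply wp_While_true; [cbnm; rewrite H2; discriminate |].
    cbn [seq filter].
    pose proof (bitlen_pos T).
    pose proof (@bitlen_le (name a) T ltac:(unfold name in *; lia)) as E'.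
    unfold name in E'; cbn [Nat.add] in E'.
    pose proof (bitlen_le _ _ (Hle a)) as E''.
    pose proof (@bitlen_le (S c) T ltac:(unfold name in *; lia)) as E.
    apply wp_Seq, wp_If; cbnm; rewrite H4; intros Ha.
    + destruct (in_dec Nat.eq_dec a D) as [_ | Hn];
        [| exfalso; apply Hn, HD; auto].
      unfold decr_count; repeat step; cbnm; rewrite H4; change (name a) with (11 + 2 * a); cbnm.
      rewrite H2, H4.
      eapply wp_conseq; [apply (IH (S a)); cbnm; unfold name in *; try lia |].
      { intros j; unfold upd.
        repeat match goal with
          |- context [if ?b then _ else _] => destruct b end; auto; lia. }
      { intros j Hj; rewrite !upd_neq by lia; apply HD; lia. }
      intros t s' (Ht & Hi & Ho & H1 & H5 & H6 & Hs & Hin & Hout); cbnm.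
      cbn [inp out mem store daddr upd Nat.eqb] in *.
      change (S (S (S (S (S (S (S (S (S (S (S (2 * a)))))))))))) with (name a) in *.
      rewrite H4 in H1, H5, H6, Hs, Hout.
      rewrite upd_neq in H1, H5, H6 by (unfold name; lia).
      repeat split; try assumption.
      * const_bits; lia.
      * intros y; rewrite Hs, !upd_neq by (unfold slot, name; lia); reflexivity.
      * intros j Hj; destruct (Nat.eq_dec j a) as [-> | Hne].
        (* Index [a] lies behind the rest of the sweep, so the zero stored here survives. *)
        -- rewrite Hout, !upd_neq, upd_eq by (unfold name; lia); reflexivity.
        -- apply Hin; lia.
      * intros j Hj; rewrite Hout, !upd_neq by (unfold name; lia); reflexivity.
    + destruct (in_dec Nat.eq_dec a D) as [Hn | _];
        [exfalso; apply (proj1 (HD a (le_n a)) Hn Ha) |].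
      unfold decr_count; repeat step; cbnm; rewrite H4; change (name a) with (11 + 2 * a); cbnm.
      rewrite H2.
      eapply wp_conseq; [apply (IH (S a)); cbnm; unfold name in *; try lia |].
      { intros j; unfold upd.
        repeat match goal with
          |- context [if ?b then _ else _] => destruct b end; auto; lia. }
      { intros j Hj; rewrite !upd_neq by lia; apply HD; lia. }
      intros t s' (Ht & Hi & Ho & H1 & H5 & H6 & Hs & Hin & Hout); cbnm.
      cbn [inp out mem store daddr upd Nat.eqb] in *.
      change (S (S (S (S (S (S (S (S (S (S (S (2 * a)))))))))))) with (name a) in *.
      repeat split; try assumption.
      * const_bits; lia.
      * rewrite Ho, <- app_assoc; reflexivity.
      * intros j Hj; destruct (Nat.eq_dec j a) as [-> | Hne].
        -- rewrite Hout, !upd_neq by (unfold name; lia); exact Ha.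
        -- apply Hin; lia.
      * intros j Hj; rewrite Hout, !upd_neq by (unfold name; lia); reflexivity.
Qed.

(** * The two sets built from a member, and their lengths *)

Definition upper (C : list nat) : list nat :=
  map name C ++ evens 0 (length C + 1).

Definition lower (n : nat) (C : list nat) : list nat :=
  map name (filter (fun j => if in_dec Nat.eq_dec j C then false else true)
              (seq 0 n)) ++
  evens (length C) (n + 2 - length C).

Lemma length_evens a c : length (evens a c) = c.
Proof. unfold evens; now rewrite length_map, length_seq. Qed.

(** An encoded list starts with its length, so the machine has to compute this number from the
    cardinality of [C] before any element is emitted. *)
Lemma length_upper C : length (upper C) = 1 + (length C + length C).
Proof. unfold upper; rewrite length_app, length_map, length_evens; lia. Qed.

Lemma In_filter_notin j n C :
  In j (filter (fun j => if in_dec Nat.eq_dec j C then false else true)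
          (seq 0 n)) <-> j < n /\ ~ In j C.
Proof.
  rewrite filter_In, in_seq.
  destruct (in_dec Nat.eq_dec j C); intuition (congruence || lia).
Qed.

(** [C] followed by its complement, and [seq 0 n], are duplicate-free lists that include each other,
    hence have equal length. *)
Lemma length_filter_notin n C :
  NoDup C -> (forall j, In j C -> j < n) ->
  length (filter (fun j => if in_dec Nat.eq_dec j C then false else true)
            (seq 0 n)) = n - length C.
Proof.
  intros HC Hlt.
  set (f := fun j => if in_dec Nat.eq_dec j C then false else true).
  assert (Hf : forall j, In j (filter f (seq 0 n)) <-> j < n /\ ~ In j C).
  { intros j; apply In_filter_notin. }
  assert (HN : NoDup (C ++ filter f (seq 0 n))).
  { apply NoDup_app; [assumption | apply NoDup_filter, seq_NoDup |].
    intros j Hj Hj'; apply Hf in Hj'; tauto. }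
  assert (H1 : incl (C ++ filter f (seq 0 n)) (seq 0 n)).
  { intros j Hj; apply in_app_iff in Hj; apply in_seq.
    destruct Hj as [Hj | Hj]; [apply Hlt in Hj | apply Hf in Hj]; lia. }
  assert (H2 : incl (seq 0 n) (C ++ filter f (seq 0 n))).
  { intros j Hj; apply in_seq in Hj; apply in_app_iff; rewrite Hf.
    destruct (in_dec Nat.eq_dec j C); [now left | right; split; [lia | assumption]]. }
  apply NoDup_incl_length in H1; [| assumption].
  apply NoDup_incl_length in H2; [| apply seq_NoDup].
  rewrite length_app, length_seq in *; lia.
Qed.

Lemma length_lower n C :
  NoDup C -> (forall j, In j C -> j < n) -> length C <= n ->
  length (lower n C) = 2 + ((n - length C) + (n - length C)).
Proof.
  intros HC Hlt Hle; unfold lower.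
  rewrite length_app, length_map, length_evens, length_filter_notin
    by assumption; lia.
Qed.

(** * Processing one member of the family *)

Definition emit_upper : cmd :=
  Read (ToDir rCard);;
  Add (ToDir rTmp) (Dir rCard) (Dir rCard);;
  Add (ToDir rTmp) (Lit 1) (Dir rTmp);;
  Write (Dir rTmp);;
  Move (ToDir rCount) (Dir rCard);;
  mark_elements;;
  Move (ToDir rEven) (Lit 0);;
  Add (ToDir rCount) (Dir rCard) (Lit 1);;
  write_evens.

Definition emit_lower : cmd :=
  Sub (ToDir rCount) (Dir rN) (Dir rCard);;
  Add (ToDir rTmp) (Dir rCount) (Dir rCount);;
  Add (ToDir rTmp) (Lit 2) (Dir rTmp);;
  Write (Dir rTmp);;
  Move (ToDir rCount) (Dir rN);;
  Move (ToDir rPtr) (Lit 11);;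
  write_unmarked;;
  Add (ToDir rEven) (Dir rCard) (Dir rCard);;
  Sub (ToDir rCount) (Dir rN) (Dir rCard);;
  Add (ToDir rCount) (Dir rCount) (Lit 2);;
  write_evens.

(** [T = 2 n + 13] dominates the new names, the tags and the lengths; only original names and their
    slots can exceed it, and [bits C] accounts for those. The marks and the cardinality in register
    6 are kept for [emit_lower]. *)
Lemma emit_upper_spec n T g rest C s :
  n + n + 13 = T -> length C <= n ->
  mem s 1 = n -> inp s = length C :: C ++ rest ->
  (forall x, In x C -> g x < n /\ mem s (slot x) = name (g x)) ->
  (forall j, mem s (name j) = 0) ->
  wp emit_upper s (fun t s' =>
    t <= 100 * bits C + (n + 2) * (300 * bitlen T) /\ inp s' = rest /\
    out s' = out s ++ encode_list (upper (map g C)) /\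
    mem s' 1 = n /\ mem s' 5 = mem s 5 /\ mem s' 6 = length C /\
    (forall x, mem s' (slot x) = mem s (slot x)) /\
    (forall j, In j (map g C) -> mem s' (name j) = 1) /\
    (forall j, ~ In j (map g C) -> mem s' (name j) = 0)).
Proof.
  intros HT HC H1 Hinp Hg H0; unfold emit_upper.
  repeat step; cbnm; rewrite Hinp; cbnm.
  eapply wp_conseq; [apply (mark_elements_spec T g rest C); cbnm; try lia |].
  { reflexivity. }
  { intros x Hx; destruct (Hg x Hx) as [Hlt Hs]; split.
    - rewrite <- Hs; reflexivity.
    - unfold name; lia. }
  intros t1 s1 (Ht1 & Hi1 & Ho1 & H11 & H15 & H16 & Hs1 & Hin1 & Hout1).
  cbn [inp out mem store daddr upd Nat.eqb oval] in *.
  repeat step; cbnm; rewrite H16.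
  eapply wp_conseq; [apply (write_evens_spec T (length C + 1) 0); cbnm; lia |].
  intros t2 s2 (Ht2 & Hi2 & Ho2 & Hm2).
  cbn [inp out mem store daddr upd Nat.eqb oval] in *.
  repeat split.
  - const_bits.
    pose proof (bitlen_pos T).
    pose proof (bitlen_le (length C) T ltac:(lia)).
    pose proof (bitlen_le (length C + length C) T ltac:(lia)).
    pose proof (bitlen_le (S (length C + length C)) T ltac:(lia)).
    nia.
  - congruence.
  - rewrite Ho2, Ho1; unfold encode_list; rewrite length_upper, length_map.
    unfold upper; rewrite length_map, <- !app_assoc; reflexivity.
  - rewrite Hm2 by lia; cbnm; lia.
  - rewrite Hm2 by lia; exact H15.
  - rewrite Hm2 by lia; exact H16.
  - intros x; rewrite Hm2 by (unfold slot; lia); exact (Hs1 x).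
  - intros j Hj; rewrite Hm2 by (unfold name; lia); exact (Hin1 j Hj).
  - intros j Hj; rewrite Hm2 by (unfold name; lia).
    transitivity (mem s (name j)); [exact (Hout1 j Hj) | apply H0].
Qed.

(** No input is read and no original name is handled, so the cost depends on [n] alone: this is the
    gain from renaming. All marks end at 0, which restores the invariant of the outer loop. *)
Lemma emit_lower_spec n T C s :
  n + n + 13 = T -> NoDup C -> (forall j, In j C -> j < n) ->
  length C <= n ->
  mem s 1 = n -> mem s 6 = length C ->
  (forall j, In j C -> mem s (name j) = 1) ->
  (forall j, ~ In j C -> mem s (name j) = 0) ->
  wp emit_lower s (fun t s' =>
    t <= (n + 2) * (400 * bitlen T) /\ inp s' = inp s /\
    out s' = out s ++ encode_list (lower n C) /\
    mem s' 1 = n /\ mem s' 5 = mem s 5 /\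
    (forall x, mem s' (slot x) = mem s (slot x)) /\
    (forall j, mem s' (name j) = 0)).
Proof.
  intros HT HC Hlt Hle H1 H6 Hin Hout; unfold emit_lower.
  repeat step; cbnm; rewrite H1, H6; cbnm.
  eapply wp_conseq; [apply (write_unmarked_spec T C n 0); cbnm |].
  { reflexivity. }
  { reflexivity. }
  { unfold name; lia. }
  { intros j; unfold name; cbnm.
    change (mem s (name j) <= T).
    destruct (in_dec Nat.eq_dec j C) as [Hj | Hj];
      [rewrite Hin by assumption | rewrite Hout by assumption]; lia. }
  { intros j _; change (In j C <-> mem s (name j) <> 0).
    destruct (in_dec Nat.eq_dec j C) as [Hj | Hj];
      [rewrite Hin by assumption | rewrite Hout by assumption];
      intuition lia. }
  intros t1 s1 (Ht1 & Hi1 & Ho1 & H11 & H15 & H16 & Hs1 & Hin1 & Hout1).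
  cbn [inp out mem store daddr upd Nat.eqb oval] in *.
  rewrite H1 in H11; rewrite H6 in H16.
  repeat step; cbnm; rewrite H11, H16.
  eapply wp_conseq;
    [apply (write_evens_spec T (n + 2 - length C) (length C)); cbnm; lia |].
  intros t2 s2 (Ht2 & Hi2 & Ho2 & Hm2).
  cbn [inp out mem store daddr upd Nat.eqb oval] in *.
  repeat split.
  - const_bits.
    pose proof (bitlen_pos T).
    pose proof (bitlen_le (length C) T ltac:(lia)).
    pose proof (bitlen_le n T ltac:(lia)).
    pose proof (bitlen_le (n - length C) T ltac:(lia)).
    pose proof (bitlen_le (n - length C + (n - length C)) T ltac:(lia)).
    pose proof (bitlen_le (S (S (n - length C + (n - length C)))) T ltac:(lia)).
    pose proof (bitlen_le (length C + length C) T ltac:(lia)).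
    assert ((n + 2 - length C + 1) * (40 * bitlen T)
            <= (n + 3) * (40 * bitlen T)) by (apply Nat.mul_le_mono_r; lia).
    nia.
  - congruence.
  - rewrite Ho2, Ho1; unfold encode_list; rewrite length_lower by assumption.
    unfold lower; rewrite <- !app_assoc; reflexivity.
  - rewrite Hm2 by lia; exact H11.
  - rewrite Hm2 by lia; exact H15.
  - intros x; rewrite Hm2 by (unfold slot; lia); exact (Hs1 x).
  - intros j; rewrite Hm2 by (unfold name; lia); cbnm.
    rewrite !upd_neq by (unfold name; lia).
    (* Marks of indices below [n] are cleared by the sweep; those beyond it were never set, as [C]
       has indices below [n] only. *)
    destruct (Nat.lt_ge_cases j n) as [Hj | Hj]; [apply Hin1; lia |].
    rewrite Hout1 by lia; rewrite !upd_neq by (unfold name; lia).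
    apply Hout; intros Hj'; apply Hlt in Hj'; lia.
Qed.

(** * The loop over the family *)

Definition emit_family : cmd :=
  While (Dir rFam)
    (emit_upper;; emit_lower;; Sub (ToDir rFam) (Dir rFam) (Lit 1)).

Definition split_family (n : nat) (F : list (list nat)) : list (list nat) :=
  flat_map (fun C => [upper C; lower n C]) F.

Lemma bits_app A B : bits (A ++ B) = bits A + bits B.
Proof. unfold bits; now rewrite map_app, list_sum_app. Qed.

(** The loop invariant is an intact dictionary with all marks 0. Each member pays for its own
    encoding, which adds up to [bits (inp s)], plus a fixed amount depending on [n] and on [M], a
    bound for the loop counter. *)
Lemma emit_family_spec n T g M F : forall s,
  n + n + 13 = T -> length F <= M ->
  mem s 1 = n -> mem s 5 = length F -> inp s = flat_map encode_list F ->
  (forall C, In C F -> NoDup (map g C) /\ length C <= n /\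
     forall x, In x C -> g x < n /\ mem s (slot x) = name (g x)) ->
  (forall j, mem s (name j) = 0) ->
  wp emit_family s (fun t s' =>
    t <= 100 * bits (inp s) +
         (length F + 1) * ((n + 2) * (700 * bitlen T) + 20 * bitlen M) /\
    out s' = out s ++ flat_map encode_list (split_family n (map (map g) F))).
Proof.
  induction F as [|C F IH]; intros s HT HM H1 H5 Hinp HF H0; unfold emit_family.
  - apply wp_While_false; [exact H5 |].
    pose proof (bitlen_pos M).
    cbnm; rewrite H5; cbn [length]; const_bits; simpl; rewrite app_nil_r.
    split; [lia | reflexivity].
  - apply wp_While_true; [cbnm; rewrite H5; discriminate |].
    destruct (HF C (or_introl eq_refl)) as (HC & Hle & Hg).
    cbn [flat_map length app encode_list] in *.
    apply wp_Seq; eapply wp_conseq;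
      [apply (emit_upper_spec n T g (flat_map encode_list F) C); assumption |].
    intros t1 s1 (Ht1 & Hi1 & Ho1 & H11 & H15 & H16 & Hs1 & Hin1 & Hout1).
    apply wp_Seq; eapply wp_conseq;
      [apply (emit_lower_spec n T (map g C)); rewrite ?length_map; try assumption |].
    { intros j Hj; apply in_map_iff in Hj as (x & <- & Hx); now apply Hg. }
    intros t2 s2 (Ht2 & Hi2 & Ho2 & H21 & H25 & Hs2 & H20).
    step; cbnm; rewrite H25, H15, H5.
    eapply wp_conseq; [apply IH; cbnm; try lia |].
    { congruence. }
    { intros D HD; destruct (HF D (or_intror HD)) as (HD1 & HD2 & HD3).
      split; [assumption | split; [assumption |]].
      intros x Hx; destruct (HD3 x Hx) as [? <-]; split; [assumption |].
      rewrite <- Hs1, <- Hs2; reflexivity. }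
    { exact H20. }
    intros t3 s3 (Ht3 & Ho3); cbn [inp out mem store] in *.
    split.
    + rewrite Hinp; rewrite Hi2, Hi1 in Ht3.
      change (bits (length C :: C ++ flat_map encode_list F))
        with (bitlen (length C) + bits (C ++ flat_map encode_list F)).
      rewrite bits_app; const_bits.
      pose proof (bitlen_pos M).
      pose proof (bitlen_le _ _ HM).
      lia.
    + rewrite Ho3, Ho2, Ho1; cbn [map split_family flat_map app].
      rewrite <- !app_assoc; reflexivity.
Qed.

(** * The whole program *)

Definition split_ground (n : nat) : list nat :=
  map name (seq 0 n) ++ evens 0 (n + 2).

Lemma length_split_ground n : length (split_ground n) = 2 + (n + n).
Proof.
  unfold split_ground; rewrite length_app, length_map, length_seq, length_evens.
  lia.
Qed.

Lemma length_split_family n F : length (split_family n F) = length F + length F.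
Proof.
  induction F as [|C F IH]; [reflexivity |].
  unfold split_family in *; cbn [flat_map app length]; rewrite IH; lia.
Qed.

Definition sperner_to_disjoint : cmd :=
  Read (ToDir rN);;
  Add (ToDir rTmp) (Dir rN) (Dir rN);;
  Add (ToDir rTmp) (Lit 2) (Dir rTmp);;
  Write (Dir rTmp);;
  Move (ToDir rCount) (Dir rN);;
  Move (ToDir rPtr) (Lit 11);;
  load_ground;;
  Move (ToDir rEven) (Lit 0);;
  Add (ToDir rCount) (Dir rN) (Lit 2);;
  write_evens;;
  Read (ToDir rFam);;
  Add (ToDir rTmp) (Dir rFam) (Dir rFam);;
  Write (Dir rTmp);;
  emit_family.

Lemma index_lt X x : In x X -> index X x < length X.
Proof.
  induction X as [|y X IH]; cbn [In index length]; [tauto |].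
  destruct (Nat.eqb_spec y x); intros [H | H]; try lia; try contradiction.
  apply IH in H; lia.
Qed.

Lemma index_inj X x y : In x X -> In y X -> index X x = index X y -> x = y.
Proof.
  induction X as [|z X IH]; cbn [In index]; [tauto |].
  destruct (Nat.eqb_spec z x), (Nat.eqb_spec z y); intros [H|H] [H'|H'] E;
    try congruence; try discriminate; apply IH; auto; congruence.
Qed.

Lemma NoDup_map_index X C : NoDup C -> incl C X -> NoDup (map (index X) C).
Proof.
  intros HC Hi; apply NoDup_map_NoDup_ForallPairs; [| assumption].
  intros x y Hx Hy; apply index_inj; auto.
Qed.

(** Compared with [emit_family_spec], the additional unit in [length F + 2] and the larger constants
    pay for emitting the new ground set and the headers; reading the original names of [X] is
    covered by [bits input]. *)
Lemma sperner_to_disjoint_spec X F :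
  NoDup X -> (forall C, In C F -> NoDup C /\ incl C X) ->
  let n := length X in
  let input := encode_list X ++ length F :: flat_map encode_list F in
  wp sperner_to_disjoint (initial input) (fun t s' =>
    t <= 100 * bits input +
         (length F + 2) * ((n + 2) * (900 * bitlen (n + n + 13)) +
                           50 * bitlen (length F)) /\
    out s' = encode_list (split_ground n) ++
      (length F + length F) ::
      flat_map encode_list (split_family n (map (map (index X)) F))).
Proof.
  intros HX HF n input; unfold sperner_to_disjoint, initial.
  remember (n + n + 13) as T eqn:HT.
  repeat step; subst input; cbnm; cbn [encode_list app hd tl]; fold n; cbnm.
  eapply wp_conseq;
    [apply (load_ground_spec T (length F :: flat_map encode_list F) X 0);
     cbnm; try reflexivity; try assumption |].
  { unfold name; fold n; lia. }
  intros t1 s1 (Ht1 & Hi1 & Ho1 & H11 & Hin1 & _ & Hj1).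
  fold n in Ht1, Ho1.
  cbn [inp out mem store daddr upd Nat.eqb oval] in *.
  repeat step; cbnm; rewrite H11.
  eapply wp_conseq; [apply (write_evens_spec T (n + 2) 0); cbnm; lia |].
  intros t2 s2 (Ht2 & Hi2 & Ho2 & Hm2).
  cbn [inp out mem store daddr upd Nat.eqb oval] in *.
  rewrite Hi1 in Hi2.
  repeat step; cbnm; rewrite Hi2; cbnm.
  eapply wp_conseq; [apply (emit_family_spec n T (index X) (length F) F); cbnm |].
  { lia. }
  { lia. }
  { rewrite Hm2 by lia; cbnm; exact H11. }
  { reflexivity. }
  { reflexivity. }
  { intros C HC; destruct (HF C HC) as [HC1 HC2].
    split; [now apply NoDup_map_index |].
    split; [now apply NoDup_incl_length |].
    intros x Hx; split; [now apply index_lt, HC2 |].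
    (* Only registers below 10 have changed since the dictionary was loaded. *)
    transitivity (mem s1 (slot x)); [| exact (Hin1 x (HC2 x Hx))].
    change (mem s2 (slot x) = mem s1 (slot x)).
    rewrite Hm2 by (unfold slot; lia); reflexivity. }
  (* Loading the dictionary writes even addresses besides registers, so every mark still has its
     initial value 0. *)
  { intros j; change (mem s2 (name j) = 0).
    rewrite Hm2 by (unfold name; lia); exact (Hj1 j). }
  intros t3 s3 (Ht3 & Ho3); cbn [inp out mem store] in *.
  split.
  - change (bits (n :: X ++ length F :: flat_map encode_list F))
      with (bitlen n + bits (X ++ length F :: flat_map encode_list F)).
    rewrite bits_app.
    change (bits (length F :: flat_map encode_list F))
      with (bitlen (length F) + bits (flat_map encode_list F)).
    const_bits.
    pose proof (bitlen_pos T).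
    pose proof (bitlen_pos (length F)).
    pose proof (bitlen_add (length F) (length F)).
    pose proof (bitlen_le n T ltac:(lia)).
    pose proof (bitlen_le (n + n) T ltac:(lia)).
    pose proof (bitlen_le (S (S (n + n))) T ltac:(lia)).
    nia.
  - rewrite Ho3, Ho2, Ho1; unfold encode_list at 1.
    rewrite length_split_ground; unfold split_ground.
    cbn [app Nat.add]; rewrite <- !app_assoc; reflexivity.
Qed.

(** * Correctness of the construction *)

Definition index_set (n : nat) (C : list nat) : Prop :=
  NoDup C /\ forall j, In j C -> j < n.

Lemma index_set_length n C : index_set n C -> length C <= n.
Proof.
  intros [HC Hlt]; rewrite <- (length_seq n 0).
  apply NoDup_incl_length; [assumption |].
  intros j Hj; apply in_seq; apply Hlt in Hj; lia.
Qed.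

(** * Membership in sets of odd names and even tags *)

Lemma In_name j C : In (name j) (map name C) <-> In j C.
Proof.
  rewrite in_map_iff; split; [intros (i & E & Hi) | intros Hj; eauto].
  unfold name in E; replace j with i by lia; assumption.
Qed.

Lemma In_evens i a c : In (2 * i) (evens a c) <-> a <= i < a + c.
Proof.
  unfold evens; rewrite in_map_iff; split.
  - intros (k & E & Hk); apply in_seq in Hk; lia.
  - intros Hi; exists i; rewrite in_seq; auto.
Qed.

Lemma evens_not_name j a c : ~ In (name j) (evens a c).
Proof.
  unfold evens, name; rewrite in_map_iff; intros (k & E & _); lia.
Qed.

Lemma name_not_even i C : ~ In (2 * i) (map name C).
Proof. unfold name; rewrite in_map_iff; intros (k & E & _); lia. Qed.

Lemma In_name_app j C a c : In (name j) (map name C ++ evens a c) <-> In j C.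
Proof.
  rewrite in_app_iff, In_name; pose proof (evens_not_name j a c); tauto.
Qed.

Lemma In_even_app i C a c :
  In (2 * i) (map name C ++ evens a c) <-> a <= i < a + c.
Proof.
  rewrite in_app_iff, In_evens; pose proof (name_not_even i C); tauto.
Qed.

Lemma NoDup_name_app C a c : NoDup C -> NoDup (map name C ++ evens a c).
Proof.
  intros HC; apply NoDup_app.
  - apply NoDup_map_NoDup_ForallPairs; [| assumption].
    intros x y _ _; unfold name; lia.
  - apply NoDup_map_NoDup_ForallPairs; [| apply seq_NoDup].
    intros x y _ _; lia.
  - intros x Hx; apply in_map_iff in Hx as (j & <- & _).
    apply evens_not_name.
Qed.

Lemma name_app_cases x C a c :
  In x (map name C ++ evens a c) -> (exists j, x = name j) \/ exists i, x = 2 * i.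
Proof.
  unfold evens; rewrite in_app_iff, !in_map_iff.
  intros [(j & <- & _) | (i & <- & _)]; eauto.
Qed.

Lemma name_In_lower j n C : In (name j) (lower n C) <-> j < n /\ ~ In j C.
Proof. unfold lower; rewrite In_name_app; apply In_filter_notin. Qed.

Lemma even_In_upper i C : In (2 * i) (upper C) <-> i <= length C.
Proof. unfold upper; rewrite In_even_app; lia. Qed.

Lemma even_In_lower i n C :
  length C <= n -> In (2 * i) (lower n C) <-> length C <= i <= n + 1.
Proof. unfold lower; rewrite In_even_app; lia. Qed.

(** * Disjointness versus strict inclusion *)

Lemma not_disjoint_upper C D : ~ disjoint (upper C) (upper D).
Proof.
  intros H; apply (H (2 * 0)); apply even_In_upper; lia.
Qed.

Lemma not_disjoint_lower n C D :
  length C <= n -> length D <= n -> ~ disjoint (lower n C) (lower n D).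
Proof.
  intros HC HD H; apply (H (2 * (n + 1))); apply even_In_lower; lia.
Qed.

(* The even part of [upper C] stops at [|C|] and that of [lower n D] starts at
   [|D|], so it forces the inclusion to be strict. *)
Lemma disjoint_upper_lower n C D :
  index_set n C -> index_set n D ->
  disjoint (upper C) (lower n D) <-> incl C D /\ length C < length D.
Proof.
  intros HC HD.
  pose proof (index_set_length _ _ HC); pose proof (index_set_length _ _ HD).
  split.
  - intros H'; split.
    + intros j Hj; destruct (in_dec Nat.eq_dec j D) as [? | Hn]; [assumption |].
      exfalso; apply (H' (name j)); [now apply In_name_app |].
      apply name_In_lower; split; [now apply HC | assumption].
    + destruct (Nat.lt_ge_cases (length C) (length D)) as [? | Hge]; [assumption |].
      exfalso; apply (H' (2 * length D)).
      * apply even_In_upper; lia.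
      * apply even_In_lower; lia.
  - intros [Hi Hl] x Hx Hx'.
    destruct (name_app_cases _ _ _ _ Hx) as [[j ->] | [i ->]].
    + apply In_name_app in Hx; apply name_In_lower in Hx'.
      apply Hi in Hx; tauto.
    + apply even_In_upper in Hx; apply even_In_lower in Hx'; lia.
Qed.

(** Inclusion between duplicate-free lists of equal length is equality of sets, so strictness can be
    read off the cardinalities. *)
Lemma strict_incl_iff C D :
  NoDup C -> NoDup D ->
  incl C D /\ length C < length D <-> ~ same_set C D /\ incl C D.
Proof.
  intros HC HD; split; intros [H1 H2]; split; try assumption.
  - intros [_ H]; apply NoDup_incl_length in H; [lia | assumption].
  - destruct (Nat.lt_ge_cases (length C) (length D)) as [? | Hge]; [assumption |].
    exfalso; apply H1; split; [assumption |].
    now apply NoDup_length_incl.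
Qed.

(** * The new family is a legitimate family of distinct sets *)

Lemma same_set_upper C D : same_set (upper C) (upper D) -> same_set C D.
Proof.
  intros [H1 H2]; split; intros j Hj.
  - apply (In_name_app j D 0 (length D + 1)), H1, In_name_app, Hj.
  - apply (In_name_app j C 0 (length C + 1)), H2, In_name_app, Hj.
Qed.

(** Complementation reverses inclusion; the names alone witness it, whatever the tags. *)
Lemma incl_lower n C D :
  index_set n D -> incl (lower n C) (lower n D) -> incl D C.
Proof.
  intros HD H j Hj; destruct (in_dec Nat.eq_dec j C) as [? | Hn]; [assumption |].
  exfalso.
  assert (Hj' : In (name j) (lower n D)).
  { apply H, name_In_lower; split; [now apply HD | assumption]. }
  apply name_In_lower in Hj'; tauto.
Qed.

(** The tag [t_(n+1)] lies in every lower set, while tags of upper sets stop at [|C| <= n]. This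
    separates the two kinds. *)
Lemma not_incl_lower_upper n C D :
  index_set n C -> index_set n D -> ~ incl (lower n D) (upper C).
Proof.
  intros HC HD H.
  pose proof (index_set_length _ _ HC); pose proof (index_set_length _ _ HD).
  assert (Hi : In (2 * (n + 1)) (upper C)) by (apply H, even_In_lower; lia).
  apply even_In_upper in Hi; lia.
Qed.

Lemma In_split_family n F A :
  In A (split_family n F) <-> exists C, In C F /\ (A = upper C \/ A = lower n C).
Proof.
  unfold split_family; rewrite in_flat_map; cbn [In].
  split; intros (C & HC & HA); exists C; intuition auto.
Qed.

(** Sets of different kinds are told apart by [t_(n+1)]; sets of the same kind determine the member
    that they come from. *)
Lemma split_family_distinct n F :
  (forall C, In C F -> index_set n C) ->
  ForallOrdPairs (fun A B => ~ same_set A B) F ->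
  ForallOrdPairs (fun A B => ~ same_set A B) (split_family n F).
Proof.
  intros HF HD; induction HD as [|C F HC HD IH]; [constructor |].
  rewrite Forall_forall in HC.
  assert (iC : index_set n C) by (apply HF; now left).
  assert (iF : forall D, In D F -> index_set n D) by (intros; apply HF; now right).
  cbn [split_family flat_map app].
  constructor; [constructor | constructor].
  - intros [_ H]; now apply not_incl_lower_upper in H.
  - apply Forall_forall; intros A HA.
    apply In_split_family in HA as (D & HDF & [-> | ->]).
    + intros H; apply (HC D HDF), same_set_upper, H.
    + intros [_ H]; apply not_incl_lower_upper in H; auto.
  - apply Forall_forall; intros A HA.
    apply In_split_family in HA as (D & HDF & [-> | ->]).
    + intros [H _]; apply not_incl_lower_upper in H; auto.
    + intros [H1 H2]; apply (HC D HDF).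
      split; [eapply incl_lower in H2 | eapply incl_lower in H1]; eauto.
  - apply IH; assumption.
Qed.

Lemma split_family_sets n F A :
  (forall C, In C F -> index_set n C) -> In A (split_family n F) ->
  NoDup A /\ incl A (split_ground n).
Proof.
  intros HF HA; apply In_split_family in HA as (C & HC & HA).
  pose proof (HF C HC) as iC; pose proof (index_set_length _ _ iC).
  destruct HA as [-> | ->]; split.
  - apply NoDup_name_app, iC.
  - intros x Hx; destruct (name_app_cases _ _ _ _ Hx) as [[j ->] | [i ->]].
    + apply In_name_app in Hx; apply In_name_app, in_seq.
      apply iC in Hx; lia.
    + apply even_In_upper in Hx; apply In_even_app; lia.
  - apply NoDup_name_app, NoDup_filter, seq_NoDup.
  - intros x Hx; destruct (name_app_cases _ _ _ _ Hx) as [[j ->] | [i ->]].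
    + apply name_In_lower in Hx; apply In_name_app, in_seq; lia.
    + apply even_In_lower in Hx; [| assumption]; apply In_even_app; lia.
Qed.

(** Sets of the same kind always meet, so a disjoint pair joins an upper set to a lower one, and
    [disjoint_upper_lower] applies. Distinctness of the two members then comes from the strict
    inequality of their cardinalities. *)
Lemma split_family_disjoint_iff n F :
  (forall C, In C F -> index_set n C) ->
  (exists A B, In A (split_family n F) /\ In B (split_family n F) /\
     ~ same_set A B /\ disjoint A B) <->
  (exists C D, In C F /\ In D F /\ ~ same_set C D /\ incl C D).
Proof.
  intros HF; split.
  - intros (A & B & HA & HB & _ & HAB).
    apply In_split_family in HA as (C & HC & HA).
    apply In_split_family in HB as (D & HD & HB).
    pose proof (HF C HC) as iC; pose proof (HF D HD) as iD.
    pose proof (index_set_length _ _ iC); pose proof (index_set_length _ _ iD).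
    destruct HA as [-> | ->], HB as [-> | ->].
    + now apply not_disjoint_upper in HAB.
    + exists C, D; split; [assumption | split; [assumption |]].
      apply strict_incl_iff; [apply iC | apply iD |].
      now apply (disjoint_upper_lower _ _ _ iC iD).
    (* The lower set comes first here, so the roles of [C] and [D] are exchanged. *)
    + exists D, C; split; [assumption | split; [assumption |]].
      apply strict_incl_iff; [apply iD | apply iC |].
      apply (disjoint_upper_lower _ _ _ iD iC).
      intros x Hx Hx'; exact (HAB x Hx' Hx).
    + now apply not_disjoint_lower in HAB.
  - intros (C & D & HC & HD & HCD).
    pose proof (HF C HC) as iC; pose proof (HF D HD) as iD.
    exists (upper C), (lower n D).
    split; [apply In_split_family; eauto |].
    split; [apply In_split_family; eauto |].
    split.
    + intros [_ H]; now apply not_incl_lower_upper in H.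
    + apply (disjoint_upper_lower _ _ _ iC iD), strict_incl_iff;
        [apply iC | apply iD | exact HCD].
Qed.

(** * Transfer along the renaming by indices *)

Lemma map_index_set X C :
  NoDup C -> incl C X -> index_set (length X) (map (index X) C).
Proof.
  intros HC Hi; split; [now apply NoDup_map_index |].
  intros j Hj; apply in_map_iff in Hj as (x & <- & Hx).
  now apply index_lt, Hi.
Qed.

(** [index X] is injective on the elements of [X], so an element of [D] with the index of [x] is [x]
    itself. *)
Lemma incl_map_index X C D :
  incl C X -> incl D X -> incl (map (index X) C) (map (index X) D) <-> incl C D.
Proof.
  intros HC HD; split; [| apply incl_map].
  intros H x Hx.
  assert (Hy : In (index X x) (map (index X) D)) by (apply H, in_map, Hx).
  apply in_map_iff in Hy as (y & E & Hy).
  rewrite <- (index_inj X y x); auto.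
Qed.

Lemma same_set_map_index X C D :
  incl C X -> incl D X ->
  same_set (map (index X) C) (map (index X) D) <-> same_set C D.
Proof. intros HC HD; unfold same_set; rewrite !incl_map_index; tauto. Qed.

Lemma map_index_distinct X F :
  (forall C, In C F -> incl C X) ->
  ForallOrdPairs (fun A B => ~ same_set A B) F ->
  ForallOrdPairs (fun A B => ~ same_set A B) (map (map (index X)) F).
Proof.
  intros HF HD; induction HD as [|C F HC HD IH]; [constructor |].
  rewrite Forall_forall in HC; cbn [map]; constructor.
  - apply Forall_forall; intros A HA; apply in_map_iff in HA as (D & <- & HDF).
    rewrite same_set_map_index; [now apply HC | |]; apply HF; cbn; auto.
  - apply IH; intros; apply HF; now right.
Qed.

(** * Quasilinearity *)

Open Scope R_scope.

(** * Logarithms, real powers and the smallness condition *)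

Lemma log2_2_pow k : log2 (2 ^ k) = INR k.
Proof.
  unfold log2; rewrite ln_pow by lra.
  pose proof ln_lt_2; field; lra.
Qed.

Lemma log2_le x y : 0 < x -> x <= y -> log2 x <= log2 y.
Proof.
  intros Hx Hxy; unfold log2, Rdiv; pose proof ln_lt_2.
  apply Rmult_le_compat_r; [left; apply Rinv_0_lt_compat; lra |].
  destruct Hxy as [Hxy | ->]; [left; now apply ln_increasing | lra].
Qed.

Lemma log2_double x : 0 < x -> log2 (2 * x) = 1 + log2 x.
Proof.
  intros Hx; unfold log2; rewrite ln_mult by lra.
  pose proof ln_lt_2; field; lra.
Qed.

Lemma log2_ge_1 m : (1 < m)%nat -> 1 <= log2 (INR m).
Proof.
  intros Hm; rewrite <- (log2_2_pow 1) at 1.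
  apply log2_le; [lra |].
  replace (2 ^ 1) with (INR 2) by (simpl; ring); apply le_INR; lia.
Qed.

Lemma bitlen_le_log2 m : (1 < m)%nat -> INR (bitlen m) <= 1 + log2 (INR m).
Proof.
  intros Hm; unfold bitlen; rewrite S_INR, <- (log2_2_pow (Nat.log2 m)).
  rewrite Rplus_comm; apply Rplus_le_compat_l, log2_le; [apply pow_lt; lra |].
  replace 2 with (INR 2) by (simpl; ring); rewrite <- pow_INR.
  apply le_INR, Nat.log2_spec; lia.
Qed.

(** Base 1 has to be allowed: a family with two members has logarithm 1. *)
Lemma Rpower_le_exponent x c d : 1 <= x -> c <= d -> Rpower x c <= Rpower x d.
Proof.
  intros [Hx | <-] Hcd; [apply Rle_Rpower; lra |].
  unfold Rpower; rewrite ln_1, !Rmult_0_r; lra.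
Qed.

Lemma Rpower_le_base x y c :
  0 < x -> x <= y -> 0 <= c -> Rpower x c <= Rpower y c.
Proof. intros; apply Rle_Rpower_l; lra. Qed.

(** Let [L = log2 m >= 1] and [P = (1 + L)^|c|]. Then [n < P] and [1 <= P], so
    [2 + 2 n < 4 P <= (1 + L)^2 P], where [1 + L] is the logarithm of the doubled family. The
    absolute value makes the power monotone in its base even when [c] is negative. *)
Lemma split_small c n m :
  (1 < m)%nat -> INR n < Rpower (log2 (INR m)) c ->
  INR (2 + (n + n)) < Rpower (log2 (INR (m + m))) (Rabs c + 2).
Proof.
  intros Hm Hn.
  pose proof (log2_ge_1 m Hm) as HL.
  set (L := log2 (INR m)) in *.
  assert (HL2 : log2 (INR (m + m)) = 1 + L).
  { rewrite plus_INR; replace (INR m + INR m) with (2 * INR m) by ring.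
    apply log2_double, (lt_INR 0); lia. }
  rewrite HL2, Rpower_plus.
  pose proof (Rpower_le_exponent L c (Rabs c) HL (Rle_abs c)).
  pose proof (Rpower_le_base L (1 + L) (Rabs c) ltac:(lra) ltac:(lra)
    (Rabs_pos c)).
  pose proof (Rpower_le_exponent (1 + L) 0 (Rabs c) ltac:(lra) (Rabs_pos c)) as H1.
  rewrite Rpower_O in H1 by lra.
  assert (E : Rpower (1 + L) 2 = (1 + L) ^ 2)
    by (rewrite <- Rpower_pow by lra; f_equal; simpl; ring).
  rewrite E.
  rewrite !plus_INR; simpl (INR 2).
  set (P := Rpower (1 + L) (Rabs c)) in *.
  assert (4 <= (1 + L) ^ 2) by nra.
  nra.
Qed.

(** * The running time in terms of the input size *)

Lemma length_le_bits A : (length A <= bits A)%nat.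
Proof.
  induction A as [|a A IH]; [auto |].
  change (bits (a :: A)) with (bitlen a + bits A)%nat.
  pose proof (bitlen_pos a); cbn [length]; lia.
Qed.

(** Each member contributes at least the entry for its length, even when it is empty. *)
Lemma length_le_bits_family F : (length F <= bits (flat_map encode_list F))%nat.
Proof.
  etransitivity; [| apply length_le_bits].
  induction F as [|C F IH]; [auto |].
  cbn [flat_map length encode_list app]; rewrite length_app; lia.
Qed.

(** With [K = log2 S] and [P = K^a], smallness gives [n <= P]. The work per member is then
    [O(P^2 K)], and [m + 2 <= 2 S] bounds the number of members, whence the exponent [2 a + 1]. *)
Lemma quasilinear_bound c a n m S t :
  Rabs c <= INR a -> (1 < m <= S)%nat -> INR n < Rpower (log2 (INR m)) c ->
  (t <= 100 * S + (m + 2) * ((n + 2) * (900 * bitlen (n + n + 13)) +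
                             50 * bitlen m))%nat ->
  INR t <= 86700 * (INR S * log2 (INR S) ^ (2 * a + 1)).
Proof.
  intros Ha [Hm HS] Hn Ht.
  pose proof (log2_ge_1 m Hm) as HL.
  assert (HmR : 2 <= INR m) by (apply (le_INR 2) in Hm; simpl in Hm; lra).
  assert (HSR : INR m <= INR S) by now apply le_INR.
  pose proof (log2_le (INR m) (INR S) ltac:(lra) HSR) as HLS.
  pose proof (bitlen_le_log2 m Hm) as Hbm.
  set (L := log2 (INR m)) in *; set (K := log2 (INR S)) in *.
  set (P := K ^ a).
  assert (HP : 1 <= P) by (apply pow_R1_Rle; lra).
  assert (HnP : INR n <= P).
  { unfold P; rewrite <- Rpower_pow by lra.
    left; eapply Rlt_le_trans; [exact Hn |].
    pose proof (Rle_abs c).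
    etransitivity; [apply (Rpower_le_exponent L c (INR a)); lra |].
    apply Rpower_le_base; [lra | exact HLS | apply pos_INR]. }
  (* The crude bound of a bit length by the number itself suffices, since [n] is already
     polylogarithmic. *)
  assert (Hb : INR (bitlen (n + n + 13)) <= 16 * P).
  { apply Rle_trans with (INR (n + n + 14)).
    - apply le_INR; pose proof (bitlen_bound (n + n + 13)); lia.
    - rewrite !plus_INR; replace (INR 14) with 14 by (simpl; ring); lra. }
  apply le_INR in Ht.
  repeat rewrite ?plus_INR, ?mult_INR in Ht.
  replace (INR 100) with 100 in Ht by (simpl; ring).
  replace (INR 900) with 900 in Ht by (rewrite INR_IZR_INZ; reflexivity).
  replace (INR 50) with 50 in Ht by (simpl; ring).
  replace (INR 2) with 2 in Ht by (simpl; ring).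
  replace (K ^ (2 * a + 1)) with (P * P * K)
    by (unfold P; rewrite pow_add, Nat.mul_comm, pow_mult; simpl; ring).
  pose proof (pos_INR n) as Hn0.
  pose proof (pos_INR (bitlen (n + n + 13))) as Hb0.
  pose proof (pos_INR (bitlen m)) as Hbm0.
  set (b := INR (bitlen (n + n + 13))) in *.
  assert (HPP : 1 <= P * P) by nra.
  assert (H1 : (INR n + 2) * (900 * b) <= 43200 * (P * P)).
  { replace (43200 * (P * P)) with ((3 * P) * (900 * (16 * P))) by ring.
    apply Rmult_le_compat; lra. }
  assert (H2 : 50 * INR (bitlen m) <= 100 * K) by lra.
  assert (H3 : (INR n + 2) * (900 * b) + 50 * INR (bitlen m)
               <= 43300 * (P * P * K)) by nra.
  assert (H4 : 1 <= P * P * K) by nra.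
  (* This gives [86600] times [S P^2 K]; the remaining [100 S] is absorbed by [1 <= P^2 K], for a
     total of [86700]. *)
  assert (H5 : (INR m + 2) * ((INR n + 2) * (900 * b) + 50 * INR (bitlen m))
               <= 2 * INR S * (43300 * (P * P * K))).
  { apply Rmult_le_compat; nra. }
  nra.
Qed.

(** * The reduced instance *)

Section Reduction.

Context (c : R) (I : big_instance c).

Let n := length (ground I).
Let indexed := map (map (index (ground I))) (family I).

Lemma indexed_sets C : In C indexed -> index_set n C.
Proof.
  intros HC; apply in_map_iff in HC as (D & <- & HD).
  apply map_index_set; apply (family_sets I D HD).
Qed.

Lemma reduced_ground_nodup : NoDup (split_ground n).
Proof. apply NoDup_name_app, seq_NoDup. Qed.

Lemma reduced_family_distinct :
  ForallOrdPairs (fun A B => ~ same_set A B) (split_family n indexed).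
Proof.
  apply split_family_distinct; [exact indexed_sets |].
  apply map_index_distinct; [| apply family_distinct].
  intros C HC; apply (family_sets I C HC).
Qed.

Lemma reduced_small :
  (1 < length (split_family n indexed))%nat /\
  INR (length (split_ground n)) <
    Rpower (log2 (INR (length (split_family n indexed)))) (Rabs c + 2).
Proof.
  destruct (big_small I) as [Hm Hn].
  rewrite length_split_ground, length_split_family; unfold indexed.
  rewrite length_map; split; [lia |].
  now apply split_small.
Qed.

Definition reduced : big_instance (Rabs c + 2) :=
  {| ground := split_ground n;
     family := split_family n indexed;
     ground_nodup := reduced_ground_nodup;
     family_sets := fun A => split_family_sets n indexed A indexed_sets;
     family_distinct := reduced_family_distinct;
     big_small := reduced_small |}.

Lemma reduced_answer :
  @answer (BigSpernerFamily c) I <->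
  @answer (BigTwoDisjointSets (Rabs c + 2)) reduced.
Proof.
  cbn [answer BigSpernerFamily BigTwoDisjointSets family reduced].
  rewrite split_family_disjoint_iff by exact indexed_sets.
  assert (HX : forall C, In C (family I) -> incl C (ground I))
    by (intros C HC; apply (family_sets I C HC)).
  split.
  - intros (C & D & HC & HD & HCD).
    exists (map (index (ground I)) C), (map (index (ground I)) D).
    split; [now apply in_map | split; [now apply in_map |]].
    rewrite same_set_map_index, incl_map_index; auto.
  - intros (C' & D' & HC & HD & HCD).
    apply in_map_iff in HC as (C & <- & HC); apply in_map_iff in HD as (D & <- & HD).
    exists C, D; split; [assumption | split; [assumption |]].
    rewrite same_set_map_index, incl_map_index in HCD; auto.
Qed.

Lemma reduced_time a :
  Rabs c <= INR a ->
  exists t,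
    runs sperner_to_disjoint (encode_big I) t (encode_big reduced) /\
    INR t <= 86700 * (INR (size (BigSpernerFamily c) I) *
                      log2 (INR (size (BigSpernerFamily c) I)) ^ (2 * a + 1)).
Proof.
  intros Ha.
  destruct (sperner_to_disjoint_spec (ground I) (family I)
    (ground_nodup I) (family_sets I)) as (t & s & He & Ht & Ho).
  destruct (big_small I) as [Hm Hn].
  exists t; split.
  - exists s; split; [exact He |]; rewrite Ho.
    unfold encode_big; cbn [ground family reduced].
    rewrite length_split_family; unfold indexed; rewrite length_map.
    reflexivity.
  - apply (quasilinear_bound c a n (length (family I)));
      [assumption | | assumption | exact Ht].
    split; [assumption |].
    change (size (BigSpernerFamily c) I) with (bits (encode_big I)).
    unfold encode_big; rewrite bits_app.
    change (bits (length (family I) :: flat_map encode_list (family I)))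
      with (bitlen (length (family I)) + bits (flat_map encode_list (family I)))%nat.
    pose proof (length_le_bits_family (family I)); lia.
Qed.

End Reduction.

Theorem theorem4 :
  forall c : R, exists c' : R,
    ql_reduces (BigSpernerFamily c) (BigTwoDisjointSets c').
Proof.
  (* The exponent grows because the ground set more than doubles while the logarithm of the family
     size only increases by 1. *)
  intros c; exists (Rabs c + 2), (@reduced c); split; [| exact (@reduced_answer c)].
  destruct (INR_unbounded (Rabs c)) as [a Ha].
  (* The program is the same for all [c]; only the exponent depends on it, through a natural number
     [a] above [|c|]. Threshold 0 works because every family has at least two members. *)
  exists sperner_to_disjoint, 86700, (2 * a + 1)%nat, 0%nat; intros I.
  destruct (reduced_time c I a) as (t & Hr & Ht); [lra |].
  exists t; split; [exact Hr | intros _; exact Ht].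
Qed.
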